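(* Fix a positive integer $r$, let $N=(n-1)\cdot n\cdot r$, and suppose $d\geq n\cdot N+n\cdot(n-1)\cdot w_1\cdot|\underline{w}|$. Suppose that $\mathfrak{BP}(d,\underline{C};\underline{w})$ is $1$-feasible and $W^{min}>C_1$, and let $\mathcal{B}_\bullet$ be a $1$-feasible partition with $w(\mathcal{B}_1)=W^{min}$ and $n_1(\mathcal{B}_1)\geq N$. Then there exists a permutation $R_\bullet$ of $\{1,\dots,n\}$ with $R_1=1$ such that $n_i(\mathcal{B}_{R_i})\geq r$ for $i=2,\dots,n$.
   Context: Setting: integers $w_1\geq\cdots\geq w_n\geq0$, $|\underline{w}|=w_1+\cdots+w_n$, positive integer $d$, integers $C_1\geq\cdots\geq C_n$. $\mathcal{B}$ is the multiset with $d$ balls of weight $w_i$ for each $i$. A partition $\mathcal{B}_\bullet$ is $\mathcal{B}=\mathcal{B}_1\sqcup\cdots\sqcup\mathcal{B}_n$ with each $\mathcal{B}_i$ containing exactly $d$ balls; $w(\mathcal{B}_i)$ is its total weight and $n_i(\mathcal{B}_j)$ is the number of balls of weight $w_i$ in $\mathcal{B}_j$. The partition is $1$-feasible if $w(\mathcal{B}_i)\leq C_i$ for $i=2,\dots,n$; $\mathfrak{BP}(d,\underline{C};\underline{w})$ is $1$-feasible if such a partition exists. $W^{min}$ is the minimum of $w(\mathcal{B}_1)$ over all $1$-feasible partitions. *)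

(* Defs.v *)
From mathcomp Require Import all_boot all_order all_algebra.
From mathcomp Require Import finmap multiset.

Set Implicit Arguments.
Unset Strict Implicit.
Unset Printing Implicit Defensive.

Local Open Scope mset_scope.

(* Balls carry no identity beyond their weight, so a collection of balls is a
   multiset of natural numbers.  When some weights coincide,
   [w i = w k] with [i != k], this multiset contains 2 * d (or more) balls of
   that weight.  Bins and weights are indexed by ['I_m.+1], with n = m.+1 and
   [ord0] in the role of the index 1. *)

Definition balls (n d : nat) (w : 'I_n -> nat) : {mset nat} :=
  \big[msetD/mset0]_(i < n) msetn d (w i).

(* A multiset coerces to the sequence of its elements with repetition, so
   [size A] and the sum below count multiplicities. *)
Definition weight (A : {mset nat}) : nat := (\sum_(x <- A) x)%N.

Definition nballs (n : nat) (w : 'I_n -> nat) (i : 'I_n) (A : {mset nat}) : nat :=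
  A (w i).

Definition ball_partition (n d : nat) (w : 'I_n -> nat)
    (B : 'I_n -> {mset nat}) : Prop :=
  \big[msetD/mset0]_(i < n) B i = balls d w /\ forall i, size (B i) = d.

Definition feasible1_partition (m d : nat) (C : 'I_m.+1 -> int)
    (w : 'I_m.+1 -> nat) (B : 'I_m.+1 -> {mset nat}) : Prop :=
  ball_partition d w B /\
  forall i, i != ord0 -> ((weight (B i))%:Z <= C i)%R.

Definition feasible1 (m d : nat) (C : 'I_m.+1 -> int) (w : 'I_m.+1 -> nat)
    : Prop :=
  exists B, feasible1_partition d C w B.

Definition is_Wmin (m d : nat) (C : 'I_m.+1 -> int) (w : 'I_m.+1 -> nat)
    (W : nat) : Prop :=
  (exists2 B, feasible1_partition d C w B & weight (B ord0) = W) /\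
  forall B, feasible1_partition d C w B -> (W <= weight (B ord0))%N.

(* Main.v *)
(** Weight indices i <> 1 are matched with bins j <> 1, an edge meaning
    n_i(B_j) >= r, and the permutation comes from Hall's marriage theorem.
    Suppose a set S of indices has a neighbourhood J with |J| < |S|, and count the
    balls whose weight is one of the w_i with i in S.  There are at least |S| d of
    them.  Bins in J hold at most |J| d, the other bins (except B_1) hold at most
    (n-1)^2 (r-1) < N altogether, and B_1 holds at most d - N because it has N
    balls of weight w_1: a contradiction.  If w_1 is itself one of those weights,
    B_1 may hold d of them, but then there are at least (|S|+1) d balls in total,
    and d >= N. *)

Require Import Defs.
From mathcomp Require Import all_boot all_order all_fingroup all_algebra.
From mathcomp Require Import finmap multiset zify.

Local Open Scope mset_scope.
Local Open Scope nat_scope.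

(* Rado's proof: if some [e x] has two elements [a] and [b], Hall's condition
   survives the removal of one of them from [e x].  Otherwise sets S and V, both
   containing [x], violate it after the removal of [b] and [a] respectively, and
   their unions X and Y of neighbours satisfy
   #|X :|: Y| + #|X :&: Y| >= #|S :|: V| + #|S :&: V| - 1 > #|X| + #|Y|. *)
Lemma hall_marriage (T U : finType) (e : T -> {set U}) :
  (forall S : {set T}, #|S| <= #|\bigcup_(x in S) e x|) ->
  exists2 f : T -> U, injective f & forall x, f x \in e x.
Proof.
(* Induction on the number of edges, which each removal lowers. *)
have [k] := ubnP (\sum_x #|e x|); elim: k e => // k IHk e; rewrite ltnS => le_e_k hall_e.
have [/forallP e1|] := boolP [forall x, #|e x| == 1].
  have ex x : exists y, y \in e x by apply/card_gt0P; rewrite (eqP (e1 x)).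
  exists (fun x => xchoose (ex x)) => [x y eq_xy|x]; last exact: xchooseP.
  have [//|neq_xy] := eqVneq x y.
  have := hall_e [set x; y]; rewrite cards2 neq_xy bigcup_setU !big_set1.
  have e_set1 z : e z = [set xchoose (ex z)].
    have /cards1P[u eu] := e1 z; have := xchooseP (ex z).
    by move: (xchoose _) => v; rewrite eu inE => /eqP->.
  by rewrite (e_set1 x) (e_set1 y) eq_xy setUid cards1.
rewrite negb_forall => /existsP[x ex_neq1].
have /card_gt1P[a [b [a_ex b_ex neq_ab]]] : 1 < #|e x|.
  by rewrite ltn_neqAle eq_sym ex_neq1; have := hall_e [set x]; rewrite cards1 big_set1.
pose e' c := fun z => if z == x then e x :\ c else e z.
have e'_sub c z : e' c z \subset e z.
  by rewrite /e'; case: eqP => [->|_] //; apply: subsetDl.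
have IHc c : c \in e x -> [forall S : {set T}, #|S| <= #|\bigcup_(z in S) e' c z|] ->
    exists2 f : T -> U, injective f & forall z, f z \in e z.
  move=> c_ex /forallP hall_c; have [|//|f f_inj f_e'] := IHk (e' c).
    apply: leq_trans le_e_k; rewrite (bigD1 x) //= [X in _ < X](bigD1 x) //=.
    rewrite {1}/e' eqxx [#|e x|](cardsD1 c) c_ex add1n ltnS leq_add2l.
    by apply: leq_sum => z _; apply: subset_leq_card.
  by exists f => // z; apply: subsetP (f_e' z).
have [/(IHc a a_ex)//|] := boolP [forall S : {set T}, #|S| <= #|\bigcup_(z in S) e' a z|].
have [/(IHc b b_ex)//|] := boolP [forall S : {set T}, #|S| <= #|\bigcup_(z in S) e' b z|].
rewrite !negb_forall => /existsP[S]; rewrite -ltnNge => ltS /existsP[V]; rewrite -ltnNge => ltV.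
(* A violating set that misses [x] would already violate [hall_e], since [e' c] and [e] agree away
   from [x]. *)
have in_x c (W : {set T}) : #|\bigcup_(z in W) e' c z| < #|W| -> x \in W.
  move=> ltW; apply: contraLR ltW => xW; rewrite -leqNgt (leq_trans (hall_e W)) //.
  apply/subset_leq_card/bigcupsP => z zW; apply: subset_trans (bigcup_sup z zW).
  by rewrite /e'; case: eqP zW xW => // -> ->.
have [xS xV] := (in_x b S ltS, in_x a V ltV).
set X := \bigcup_(z in S) _ in ltS; set Y := \bigcup_(z in V) _ in ltV.
have e'X z : z \in S -> e' b z \subset X by move=> zS; apply: bigcup_sup.
have e'Y z : z \in V -> e' a z \subset Y by move=> zV; apply: bigcup_sup.
have subU : \bigcup_(z in S :|: V) e z \subset X :|: Y.
  apply/bigcupsP => z; rewrite inE; have [-> _|neq_zx] := eqVneq z x.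
    apply/subsetP => u u_ex; rewrite inE; have [u_b|neq_ub] := eqVneq u b.
      apply/orP; right; apply: (subsetP (e'Y x xV)).
      by rewrite /e' eqxx !inE u_ex u_b eq_sym neq_ab.
    by apply/orP; left; apply: (subsetP (e'X x xS)); rewrite /e' eqxx !inE u_ex neq_ub.
  case/orP => [/e'X|/e'Y]; rewrite /e' (negPf neq_zx) => /subset_trans-> //.
    exact: subsetUl.
  exact: subsetUr.
(* At [x] itself the inclusion can fail, as [e' b] and [e' a] each lose a neighbour there; dropping
   [x] costs the 1. *)
have subI : \bigcup_(z in (S :&: V) :\ x) e z \subset X :&: Y.
  apply/bigcupsP => z; rewrite !inE => /and3P[neq_zx /e'X + /e'Y].
  by rewrite /e' (negPf neq_zx) subsetI => -> ->.
have := leq_add (leq_trans (hall_e _) (subset_leq_card subU))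
                (leq_trans (hall_e _) (subset_leq_card subI)).
rewrite cardsUI; have := cardsUI S V; rewrite (cardsD1 x (S :&: V)) inE xS xV /= => eqSV.
lia.
Qed.

Lemma count_msetD (K : choiceType) (P : pred K) (A B : {mset K}) :
  count P (A `+` B) = count P A + count P B.
Proof.
rewrite -count_cat; move: P; apply/seq.permP/allP => x _ /=.
by rewrite count_cat !count_mem_mset msetE2.
Qed.

Lemma count_sum_mset (K : choiceType) (I : Type) (s : seq I) (P : pred K)
    (F : I -> {mset K}) :
  count P (\big[msetD/mset0]_(i <- s) F i : {mset K}) = \sum_(i <- s) count P (F i).
Proof.
elim: s => [|i s IHs]; first by rewrite !big_nil enum_mset0.
by rewrite !big_cons count_msetD IHs.
Qed.

Lemma count_le_sum (T : eqType) (J : finType) (S : {set J}) (f : J -> T) (s : seq T) :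
  count (fun x => [exists j in S, f j == x]) s <= \sum_(j in S) count_mem (f j) s.
Proof.
elim: s => [|x s IHs] /=; first by rewrite big1.
rewrite big_split leq_add //=; case: exists_inP => // -[j jS /eqP fj].
by rewrite (bigD1 j) //= fj eqxx.
Qed.

Lemma count_balls n d (w : 'I_n -> nat) (P : pred nat) :
  count P (balls d w) = \sum_(i < n) P (w i) * d.
Proof.
by rewrite count_sum_mset; apply: eq_bigr => i _; rewrite enum_msetn count_nseq.
Qed.

Theorem theorem4p1 (m d r N Wmin : nat)
    (w : 'I_m.+1 -> nat) (C : 'I_m.+1 -> int) (B : 'I_m.+1 -> {mset nat})
    (d_gt0 : 0 < d) (r_gt0 : 0 < r)
    (w_noninc : forall i j : 'I_m.+1, i <= j -> w j <= w i)
    (C_noninc : forall i j : 'I_m.+1, i <= j -> (C j <= C i)%R)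
    (N_def : N = m * m.+1 * r)
    (d_ge : m.+1 * N + m.+1 * m * w ord0 * (\sum_(i < m.+1) w i) <= d)
    (BP_feasible : feasible1 d C w)
    (Wmin_def : is_Wmin d C w Wmin)
    (Wmin_gt : (C ord0 < Wmin%:Z)%R)
    (B_feasible : feasible1_partition d C w B)
    (B_min : weight (B ord0) = Wmin)
    (B_N : N <= nballs w ord0 (B ord0)) :
  exists R : {perm 'I_m.+1},
    R ord0 = ord0 /\
    forall i : 'I_m.+1, i != ord0 -> r <= nballs w i (B (R i)).
Proof.
case: B_feasible => -[sumB sizeB] _.
pose rich (i : 'I_m) : {set 'I_m} := [set j | r <= nballs w (lift ord0 i) (B (lift ord0 j))].
have [|f f_inj f_rich] := hall_marriage _ _ rich.
  move=> S; rewrite leqNgt; apply/negP; set J := \bigcup_(i in S) _ => ltJS.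
  pose P x := [exists i in S, w (lift ord0 i) == x].
  have poor j : j \notin J -> count P (B (lift ord0 j)) <= m * r.-1.
    move=> jJ; apply: leq_trans (count_le_sum _ _ S (fun i => w (lift ord0 i)) _) _.
    apply: (@leq_trans (\sum_(i in S) r.-1)).
      apply: leq_sum => i iS; rewrite count_mem_mset -ltnS prednK // ltnNge.
      by apply: contra jJ => ?; apply/bigcupP; exists i; rewrite ?inE.
    by rewrite sum_nat_const leq_mul2r -[m in _ <= m]card_ord max_card orbT.
  have : count P (\big[msetD/mset0]_(i < m.+1) B i) = count P (balls d w) by rewrite sumB.
  rewrite count_balls count_sum_mset !big_ord_recl.
  have leB j : count P (B j) <= d by rewrite -(sizeB j) count_size.
  have leJ : \sum_(j < m) count P (B (lift ord0 j)) <= #|J| * d + m * (m * r.-1).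
    rewrite (bigID (mem J)) /= leq_add //.
      by rewrite -sum_nat_const leq_sum.
    apply: (@leq_trans (\sum_(j < m | j \notin J) m * r.-1)); first exact: leq_sum.
    by rewrite sum_nat_const leq_mul2r -[m in _ <= m]card_ord max_card orbT.
  have leS : #|S| * d <= \sum_(i < m) P (w (lift ord0 i)) * d.
    rewrite -sum_nat_const [leqRHS](bigID (mem S)) /=; apply: leq_trans (leq_addr _ _).
    apply: leq_sum => i iS; rewrite (_ : P _) ?mul1n //.
    by apply/exists_inP; exists i.
  have leN : count P (B ord0) + N <= d + P (w ord0) * d.
    case: (boolP (P (w ord0))) => [_|notP].
      by rewrite mul1n leq_add //; nia.
    rewrite addn0 -(sizeB ord0) -(count_predC P) leq_add2l (leq_trans B_N) //.
    by rewrite /nballs -count_mem_mset; apply: sub_count => x /eqP->.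
  (* A violating [S] is nonempty; [0 < m] makes the bound below [N] strict. *)
  have m_gt0 : 0 < m.
    by have /card_gt0P[i _] := leq_ltn_trans (leq0n _) ltJS; apply: leq_ltn_trans (ltn_ord i).
  have : #|J| * d + d <= #|S| * d by rewrite -mulSnr leq_mul2r ltJS orbT.
  have : m * (m * r.-1) < N by rewrite N_def -mulnA ltn_pmul2l //; nia.
  (* After [P (w ord0) * d] cancels, [#|S| * d + N <= #|J| * d + d + m * (m * r.-1) < #|S| * d +
     N]. *)
  move: leN leJ leS; move: (\sum_(_ < _) _) (\sum_(_ < _) _) => a b.
  by move: (P _ * d) (count _ _) (#|J| * d) (#|S| * d) (m * (m * _)); lia.
(* [R] fixes [ord0] and acts as the matching [f] on the other indices. *)
exists (lift_perm ord0 ord0 (perm f_inj)); split=> [|i]; first exact: lift_perm_id.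
case: (unliftP ord0 i) => [j ->|->]; last by rewrite eqxx.
by rewrite lift_perm_lift permE => _; have := f_rich j; rewrite inE.
Qed.
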